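(* Consider the linearized Euler equations with constant background state $(\rho',u',v',p')$ (see context), and let $\rho^R,u^R,p^R\in\mathbb{R}$. Take as initial data at time $0$ the quadratic planar wave $$(\rho,u,v,p)(x,y,0)=\begin{cases}(\rho^Rx^2,\ u^Rx^2,\ 0,\ p^Rx^2),& x>0,\\ (0,0,0,0),& x\le 0.\end{cases}$$ Then for every $y\in\mathbb{R}$ and every $\tau>0$, the operator $\mathrm{EG}^{\mathrm{quad}}$ (see context) applied to these data at the point $P=(u'\tau,y,\tau)$, whose advected foot point $P'$ lies on the line $x=0$, reproduces the exact solution of the linearized Euler equations with these initial data at $P$; that is, both the exact solution and the $\mathrm{EG}^{\mathrm{quad}}$ approximation have at $P$ the values $$p=\tfrac12\big(p^R-\rho'c'u^R\big)(c'\tau)^2,\qquad u=\tfrac12\Big(u^R-\frac{p^R}{\rho'c'}\Big)(c'\tau)^2,\qquad v=0,\qquad \rho=\frac{1}{2c'^2}\big(p^R-\rho'c'u^R\big)(c'\tau)^2.$$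
   Context: The linearized two-dimensional Euler equations in primitive variables $(\rho,u,v,p)$ with constant background state $(\rho',u',v',p')$, where $\rho'>0$, $p'>0$, $u',v'\in\mathbb{R}$, $\gamma>1$ and $c'=\sqrt{\gamma p'/\rho'}$, are $$\rho_t+u'\rho_x+v'\rho_y+\rho'(u_x+v_y)=0,$$ $$u_t+u'u_x+v'u_y+\tfrac{1}{\rho'}p_x=0,$$ $$v_t+u'v_x+v'v_y+\tfrac{1}{\rho'}p_y=0,$$ $$p_t+u'p_x+v'p_y+\gamma p'(u_x+v_y)=0.$$ Since the initial data are $C^1$, the exact solution is the classical $C^1$ solution. For $P=(x,y,t+\tau)$ with $\tau>0$ put $P'=(x-u'\tau,\,y-v'\tau,\,t)$ and $Q(\theta)=(x-(u'-c'\cos\theta)\tau,\ y-(v'-c'\sin\theta)\tau,\ t)$. Given data $(\rho,u,v,p)$ at time $t$, the approximate evolution operator $\mathrm{EG}^{\mathrm{quad}}$ assigns to $P$ the values \begin{align*} p(P)&=-p(P')+\frac1\pi\int_0^{2\pi}p(Q(\theta))\,d\theta-\frac{\rho'c'}{2}\big[u(Q(0))-u(Q(\pi))\big]-\frac{\rho'c'}{2}\Big[v\big(Q(\tfrac{\pi}{2})\big)-v\big(Q(\tfrac{3\pi}{2})\big)\Big],\\ u(P)&=\frac1\pi\int_0^{2\pi}\Big[u(Q(\theta))\big(2\cos^2\theta-\tfrac12\big)+2v(Q(\theta))\sin\theta\cos\theta\Big]d\theta-\frac{1}{2\rho'c'}\big[p(Q(0))-p(Q(\pi))\big],\\ v(P)&=\frac1\pi\int_0^{2\pi}\Big[v(Q(\theta))\big(2\sin^2\theta-\tfrac12\big)+2u(Q(\theta))\sin\theta\cos\theta\Big]d\theta-\frac{1}{2\rho'c'}\Big[p\big(Q(\tfrac{\pi}{2})\big)-p\big(Q(\tfrac{3\pi}{2})\big)\Big],\\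 \rho(P)&=\rho(P')+\frac{1}{c'^2}\big(p(P)-p(P')\big). \end{align*} *)

(* Defs.v *)
From Stdlib Require Import Reals.
From Coquelicot Require Import Coquelicot.
Open Scope R_scope.

(** Primitive variables (rho, u, v, p).  A field is a function
    [W x y t : state]; data at a fixed time are functions [W0 x y : state]. *)
Record state : Type := mkState {
  st_rho : R;
  st_u : R;
  st_v : R;
  st_p : R
}.

Definition sound_speed (gamma : R) (B : state) : R :=
  sqrt (gamma * st_p B / st_rho B).

Definition Dx (f : R -> R -> R -> R) (x y t : R) : R :=
  Derive (fun s => f s y t) x.
Definition Dy (f : R -> R -> R -> R) (x y t : R) : R :=
  Derive (fun s => f x s t) y.
Definition Dt (f : R -> R -> R -> R) (x y t : R) : R :=
  Derive (fun s => f x y s) t.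

(** Joint continuity on the closed half-space [t >= 0]; only the values of [f]
    there matter. *)
Definition continuous_half_space (f : R -> R -> R -> R) : Prop :=
  continuous_on (fun z : R * R * R => 0 <= snd z)
    (fun z : R * R * R => f (fst (fst z)) (snd (fst z)) (snd z)).

(** C^1 up to the boundary [t = 0]: the first-order partial derivatives exist
    for [t > 0] and extend continuously to [t >= 0]. *)
Definition C1_half_space (f : R -> R -> R -> R) : Prop :=
  continuous_half_space f /\
  exists fx fy ft : R -> R -> R -> R,
    continuous_half_space fx /\
    continuous_half_space fy /\
    continuous_half_space ft /\
    forall x y t : R, 0 < t ->
      is_derive (fun s => f s y t) x (fx x y t) /\
      is_derive (fun s => f x s t) y (fy x y t) /\
      is_derive (fun s => f x y s) t (ft x y t).

Definition linearized_euler (gamma : R) (B : state)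
    (W : R -> R -> R -> state) (x y t : R) : Prop :=
  let rho := fun x y t => st_rho (W x y t) in
  let u := fun x y t => st_u (W x y t) in
  let v := fun x y t => st_v (W x y t) in
  let p := fun x y t => st_p (W x y t) in
  let rho' := st_rho B in
  let u' := st_u B in
  let v' := st_v B in
  let p' := st_p B in
  Dt rho x y t + u' * Dx rho x y t + v' * Dy rho x y t
    + rho' * (Dx u x y t + Dy v x y t) = 0 /\
  Dt u x y t + u' * Dx u x y t + v' * Dy u x y t
    + 1 / rho' * Dx p x y t = 0 /\
  Dt v x y t + u' * Dx v x y t + v' * Dy v x y t
    + 1 / rho' * Dy p x y t = 0 /\
  Dt p x y t + u' * Dx p x y t + v' * Dy p x y t
    + gamma * p' * (Dx u x y t + Dy v x y t) = 0.

Definition classical_solution (gamma : R) (B : state)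
    (W0 : R -> R -> state) (W : R -> R -> R -> state) : Prop :=
  C1_half_space (fun x y t => st_rho (W x y t)) /\
  C1_half_space (fun x y t => st_u (W x y t)) /\
  C1_half_space (fun x y t => st_v (W x y t)) /\
  C1_half_space (fun x y t => st_p (W x y t)) /\
  (forall x y t : R, 0 < t -> linearized_euler gamma B W x y t) /\
  (forall x y : R, W x y 0 = W0 x y).

(** Spatial coordinates of P' = (x - u' tau, y - v' tau, t). *)
Definition foot_point (B : state) (x y tau : R) : R * R :=
  (x - st_u B * tau, y - st_v B * tau).

(** Spatial coordinates of Q(theta). *)
Definition cone_point (gamma : R) (B : state) (x y tau theta : R) : R * R :=
  (x - (st_u B - sound_speed gamma B * cos theta) * tau,
   y - (st_v B - sound_speed gamma B * sin theta) * tau).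

(** Value at P = (x, y, t + tau) of the approximate evolution operator applied
    to the data [W0] at time t; the background is constant, so t itself does
    not occur. *)
Definition EG_quad (gamma : R) (B : state) (W0 : R -> R -> state)
    (x y tau : R) : state :=
  let rho' := st_rho B in
  let c' := sound_speed gamma B in
  let at_P' := W0 (fst (foot_point B x y tau)) (snd (foot_point B x y tau)) in
  let at_Q := fun theta =>
    W0 (fst (cone_point gamma B x y tau theta))
       (snd (cone_point gamma B x y tau theta)) in
  let p_P :=
    - st_p at_P'
    + 1 / PI * RInt (fun theta => st_p (at_Q theta)) 0 (2 * PI)
    - rho' * c' / 2 * (st_u (at_Q 0) - st_u (at_Q PI))
    - rho' * c' / 2 * (st_v (at_Q (PI / 2)) - st_v (at_Q (3 * PI / 2))) in
  let u_P :=
    1 / PI * RInt (fun theta =>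
        st_u (at_Q theta) * (2 * cos theta ^ 2 - 1 / 2)
        + 2 * st_v (at_Q theta) * sin theta * cos theta) 0 (2 * PI)
    - 1 / (2 * rho' * c') * (st_p (at_Q 0) - st_p (at_Q PI)) in
  let v_P :=
    1 / PI * RInt (fun theta =>
        st_v (at_Q theta) * (2 * sin theta ^ 2 - 1 / 2)
        + 2 * st_u (at_Q theta) * sin theta * cos theta) 0 (2 * PI)
    - 1 / (2 * rho' * c')
      * (st_p (at_Q (PI / 2)) - st_p (at_Q (3 * PI / 2))) in
  let rho_P := st_rho at_P' + 1 / c' ^ 2 * (p_P - st_p at_P') in
  mkState rho_P u_P v_P p_P.

Definition quadratic_wave (rhoR uR pR : R) (x y : R) : state :=
  if Rlt_dec 0 x then mkState (rhoR * x ^ 2) (uR * x ^ 2) 0 (pR * x ^ 2)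
  else mkState 0 0 0 0.

(* Main.v *)
(** Uniqueness is local, by a weighted energy estimate.  With
    [P = p / (rho' c')] and [q = rho - p / c'^2] the difference of two classical
    solutions satisfies a symmetric hyperbolic system whose energy
    [e = (P^2 + u^2 + v^2 + q^2) / 2] has a flux bounded by
    [(c' + |u'| + |v'|) e].  Multiply [e] by a cutoff supported on a square that
    shrinks at this speed: the integral over a fixed larger square cannot grow,
    and it vanishes at time 0, so [e] vanishes at the centre.

    The exact solution is therefore the plane wave built from the Riemann
    invariants [p -+ rho' c' u], which travel at speeds [u' -+ c'].  On the line
    followed by the foot point only the left-going invariant is nonzero, which
    gives the factor 1/2.  For the operator, only the half circle
    [cos theta > 0] sees the wave, and the integrals of [cos^2],
    [cos^2 (2 cos^2 - 1/2)] and [2 sin cos^3] over it are [PI/2], [PI/2], [0]. *)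

Require Import Defs.
From Stdlib Require Import Reals Lra IndefiniteDescription.
From Coquelicot Require Import Coquelicot.
Open Scope R_scope.

(** * Integrals depending on a parameter *)

(** Compactness of the interval makes the joint continuity uniform in the integration variable. The
    parameter space is general because both a single variable and a pair [(x, t)] occur as
    parameters. *)
Lemma continuous_RInt_param (T : UniformSpace) (f : T -> R -> R) (a b : R) :
  (forall z : T * R, continuous (fun z => f (fst z) (snd z)) z) ->
  forall u : T, continuous (fun u => RInt (f u) a b) u.
Proof.
intros Hf u0.
assert (Hy : forall (u : T) (y : R), continuous (f u) y).
{ intros u y.
  apply (continuous_comp_2 (fun _ : R => u) (fun y : R => y) f).
  - apply continuous_const.
  - apply continuous_id.
  - apply (Hf (u, y)). }
assert (Hex : forall (u : T) (c d : R), ex_RInt (f u) c d).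
{ intros u c d; apply (ex_RInt_continuous (V := R_CompleteNormedModule)).
  intros y _; apply Hy. }
assert (Hle : forall a b, a <= b -> continuous (fun u => RInt (f u) a b) u0).
{ clear a b; intros a b Hab.
  apply filterlim_locally; intros eps.
  (* The [+ 1] keeps the denominator positive when [a = b] and makes the final bound
     [(b - a) * (2 * eta) < eps] strict. *)
  assert (Heta : 0 < eps / (2 * (b - a + 1))) by
    (apply Rdiv_lt_0_compat; [apply cond_pos | lra]).
  set (eta := mkposreal _ Heta).
  destruct (functional_choice (fun (y : R) (d : posreal) =>
      forall u z, ball u0 d u -> ball y d z ->
        ball (f u0 y) eta (f u z))) as [delta Hdelta].
  { intros y.
    destruct (proj1 (filterlim_locally _ _) (Hf (u0, y)) eta) as [d Hd].
    exists d; intros u z Hu Hz; apply (Hd (u, z)); split; assumption. }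
  destruct (compactness_value_1d a b delta) as [d Hd].
  exists d; intros u Hu.
  assert (Hbound : forall y, a <= y <= b ->
      Rabs (f u y - f u0 y) <= 2 * eta).
  { intros y Hyab.
    (* Compactness yields its nearby centre [t] only under a double negation, so the bound is proved
       by contradiction. Comparing both values with [f u0 t] costs [eta] twice. *)
    apply Rnot_lt_le; intros Hlt.
    apply (Hd y Hyab); intros [t [_ [Hyt Hdt]]].
    assert (Hball : ball t (delta t) y) by exact Hyt.
    assert (B1 : Rabs (f u y - f u0 t) < eta) by
      exact (Hdelta t u y (ball_le u0 _ _ Hdt _ Hu) Hball).
    assert (B2 : Rabs (f u0 y - f u0 t) < eta) by
      exact (Hdelta t u0 y (ball_center u0 _) Hball).
    replace (f u y - f u0 y) with
      ((f u y - f u0 t) - (f u0 y - f u0 t)) in Hlt by ring.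
    pose proof (Rabs_triang (f u y - f u0 t) (- (f u0 y - f u0 t))) as Ht.
    rewrite Rabs_Ropp in Ht; unfold Rminus in *; lra. }
  change (Rabs (RInt (f u) a b - RInt (f u0) a b) < eps).
  replace (RInt (f u) a b - RInt (f u0) a b)
    with (RInt (fun y => f u y - f u0 y) a b)
    by apply (RInt_minus (f u) (f u0) a b (Hex _ _ _) (Hex _ _ _)).
  apply Rle_lt_trans with ((b - a) * (2 * eta)).
  - apply abs_RInt_le_const; [exact Hab | | exact Hbound].
    exact (ex_RInt_minus (f u) (f u0) a b (Hex _ _ _) (Hex _ _ _)).
  - simpl.
    replace ((b - a) * (2 * (eps / (2 * (b - a + 1)))))
      with (eps * ((b - a) / (b - a + 1))) by (field; lra).
    rewrite <- (Rmult_1_r eps) at 2.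
    apply Rmult_lt_compat_l; [apply cond_pos |].
    apply (Rmult_lt_reg_r (b - a + 1)); [lra |].
    unfold Rdiv; rewrite Rmult_assoc, Rinv_l by lra; lra. }
destruct (Rle_or_lt a b) as [Hab | Hab]; [now apply Hle |].
apply continuous_ext with (fun u => opp (RInt (f u) b a)).
{ intros u; apply opp_RInt_swap, Hex. }
apply (continuous_opp (fun u => RInt (f u) b a)), Hle; lra.
Qed.

(** Differentiation under the integral sign with a named derivative [df]. It is the derivative only
    near [x], since time derivatives are available only for positive times. *)
Lemma is_derive_RInt_parameter (f df : R -> R -> R) (a b x : R) :
  (forall z : R * R, continuous (fun z => f (fst z) (snd z)) z) ->
  (forall z : R * R, continuous (fun z => df (fst z) (snd z)) z) ->
  locally x (fun x => forall y, is_derive (fun s => f s y) x (df x y)) ->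
  is_derive (fun x => RInt (f x) a b) x (RInt (df x) a b).
Proof.
intros Hf Hdf Hd.
replace (RInt (df x) a b)
  with (RInt (fun y => Derive (fun s => f s y) x) a b).
- apply (is_derive_RInt_param f).
  + revert Hd; apply filter_imp; intros z Hz y _; eexists; apply Hz.
  + intros y _.
    apply continuity_2d_pt_ext_loc with df.
    * destruct Hd as [d Hd]; exists d; intros z w Hz _.
      symmetry; apply is_derive_unique, Hd, Hz.
    * apply continuity_2d_pt_filterlim, (Hdf (x, y)).
  + apply filter_forall; intros z.
    apply (ex_RInt_continuous (V := R_CompleteNormedModule)); intros y _.
    apply (continuous_comp_2 (fun _ : R => z) (fun y : R => y) f).
    * apply continuous_const.
    * apply continuous_id.
    * apply (Hf (z, y)).
- apply RInt_ext; intros y _; apply is_derive_unique.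
  exact (locally_singleton _ _ Hd y).
Qed.

(** The integral from [a] to [y] lies between 0 and the total, hence is 0 for every [y] in the
    interval; its derivative at [x] is [f x]. *)
Lemma RInt_nonneg_eq_0 (f : R -> R) (a b x : R) :
  (forall y, continuous f y) -> (forall y, 0 <= f y) ->
  RInt f a b = 0 -> a < x < b -> f x = 0.
Proof.
intros Hc Hpos H0 Hx.
assert (Hex : forall c d, ex_RInt f c d) by
  (intros c d; apply (ex_RInt_continuous (V := R_CompleteNormedModule));
   intros y _; apply Hc).
assert (Hge : forall c d, c <= d -> 0 <= RInt f c d) by
  (intros c d Hcd; apply RInt_ge_0; auto).
assert (Hd : is_derive (fun y => RInt f a y) x (f x)).
{ apply (is_derive_RInt f _ a); [| apply Hc].
  apply filter_forall; intros y; apply (RInt_correct f), Hex. }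
rewrite <- (is_derive_unique _ _ _ Hd).
rewrite (Derive_ext_loc _ (fun _ => 0)); [apply Derive_const |].
assert (Hloc : locally x (fun y => a < y /\ y < b)) by
  (apply filter_and; [apply (open_gt a x) | apply (open_lt b x)]; lra).
revert Hloc; apply filter_imp; intros y [Hy1 Hy2].
pose proof (Hge a y ltac:(lra)).
pose proof (Hge y b ltac:(lra)).
assert (RInt f a y + RInt f y b = RInt f a b) by
  apply (RInt_Chasles f a y b (Hex _ _) (Hex _ _)).
lra.
Qed.

(** * Functions of class C^1 on the open half-space *)

Definition continuous3 (f : R -> R -> R -> R) : Prop :=
  forall z : R * R * R,
    continuous (fun z : R * R * R => f (fst (fst z)) (snd (fst z)) (snd z)) z.

Lemma continuous3_comp (T : UniformSpace) (f : R -> R -> R -> R)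
    (g1 g2 g3 : T -> R) (z : T) :
  continuous3 f -> continuous g1 z -> continuous g2 z -> continuous g3 z ->
  continuous (fun z => f (g1 z) (g2 z) (g3 z)) z.
Proof.
intros Hf H1 H2 H3.
apply (continuous_comp_2 (fun z => (g1 z, g2 z)) g3
  (fun w t => f (fst w) (snd w) t)).
- apply (continuous_comp_2 g1 g2 (fun x y => (x, y))); auto.
  apply continuous_ext with (fun w : R * R => w).
  + now intros [].
  + apply continuous_id.
- exact H3.
- apply Hf.
Qed.

Lemma continuous3_const (k : R) : continuous3 (fun _ _ _ => k).
Proof. intros z; apply continuous_const. Qed.

Lemma continuous3_plus (f g : R -> R -> R -> R) :
  continuous3 f -> continuous3 g ->
  continuous3 (fun x y t => f x y t + g x y t).
Proof.
intros Hf Hg z.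
apply (continuous_plus (V := R_NormedModule)
  (fun z : R * R * R => f (fst (fst z)) (snd (fst z)) (snd z))
  (fun z : R * R * R => g (fst (fst z)) (snd (fst z)) (snd z))); auto.
Qed.

Lemma continuous3_mult (f g : R -> R -> R -> R) :
  continuous3 f -> continuous3 g ->
  continuous3 (fun x y t => f x y t * g x y t).
Proof.
intros Hf Hg z.
apply (continuous_mult (K := R_AbsRing)
  (fun z : R * R * R => f (fst (fst z)) (snd (fst z)) (snd z))
  (fun z : R * R * R => g (fst (fst z)) (snd (fst z)) (snd z))); auto.
Qed.

(** The partial derivatives are explicit arguments, so that the sum and product rules compute them
    by unification. All four functions are continuous on the whole space, but are linked by
    differentiation only for [t > 0]. *)
Definition C1_with (f fx fy ft : R -> R -> R -> R) : Prop :=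
  continuous3 f /\ continuous3 fx /\ continuous3 fy /\ continuous3 ft /\
  forall x y t : R, 0 < t ->
    is_derive (fun s => f s y t) x (fx x y t) /\
    is_derive (fun s => f x s t) y (fy x y t) /\
    is_derive (fun s => f x y s) t (ft x y t).

Lemma C1_with_const (k : R) :
  C1_with (fun _ _ _ => k) (fun _ _ _ => 0) (fun _ _ _ => 0) (fun _ _ _ => 0).
Proof.
do 4 (split; [apply continuous3_const |]).
intros x y t _; split; [| split]; apply (is_derive_const (V := R_NormedModule)).
Qed.

Lemma C1_with_plus (f fx fy ft g gx gy gt : R -> R -> R -> R) :
  C1_with f fx fy ft -> C1_with g gx gy gt ->
  C1_with (fun x y t => f x y t + g x y t) (fun x y t => fx x y t + gx x y t)
    (fun x y t => fy x y t + gy x y t) (fun x y t => ft x y t + gt x y t).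
Proof.
intros (Hf & Hfx & Hfy & Hft & Hfd) (Hg & Hgx & Hgy & Hgt & Hgd).
do 4 (split; [now apply continuous3_plus |]).
intros x y t Ht.
destruct (Hfd x y t Ht) as (F1 & F2 & F3).
destruct (Hgd x y t Ht) as (G1 & G2 & G3).
split; [| split].
- exact (is_derive_plus _ _ _ _ _ F1 G1).
- exact (is_derive_plus _ _ _ _ _ F2 G2).
- exact (is_derive_plus _ _ _ _ _ F3 G3).
Qed.

Lemma C1_with_mult (f fx fy ft g gx gy gt : R -> R -> R -> R) :
  C1_with f fx fy ft -> C1_with g gx gy gt ->
  C1_with (fun x y t => f x y t * g x y t)
    (fun x y t => fx x y t * g x y t + f x y t * gx x y t)
    (fun x y t => fy x y t * g x y t + f x y t * gy x y t)
    (fun x y t => ft x y t * g x y t + f x y t * gt x y t).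
Proof.
intros (Hf & Hfx & Hfy & Hft & Hfd) (Hg & Hgx & Hgy & Hgt & Hgd).
split; [now apply continuous3_mult |].
do 3 (split; [apply continuous3_plus; now apply continuous3_mult |]).
intros x y t Ht.
destruct (Hfd x y t Ht) as (F1 & F2 & F3).
destruct (Hgd x y t Ht) as (G1 & G2 & G3).
split; [| split].
- exact (is_derive_mult _ _ _ _ _ F1 G1 Rmult_comm).
- exact (is_derive_mult _ _ _ _ _ F2 G2 Rmult_comm).
- exact (is_derive_mult _ _ _ _ _ F3 G3 Rmult_comm).
Qed.

Lemma continuous_max_0 (s : R) : continuous (fun s => Rmax 0 s) s.
Proof.
apply continuous_ext with (fun s => (s + Rabs s) * / 2).
- intros r; unfold Rmax, Rabs; destruct (Rle_dec 0 r), (Rcase_abs r); lra.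
- apply (continuous_mult (K := R_AbsRing) (fun s => s + Rabs s)).
  + apply (continuous_plus (V := R_NormedModule) (fun s => s)).
    * apply continuous_id.
    * apply continuous_Rabs.
  + apply continuous_const.
Qed.

(** Freezing time at 0 for negative times extends a function from the half-space: the map to
    [Rmax 0 t] is continuous and lands in the half-space, where continuity within the set
    suffices. *)
Lemma continuous3_max_0 (f : R -> R -> R -> R) :
  continuous_half_space f -> continuous3 (fun x y t => f x y (Rmax 0 t)).
Proof.
intros Hf z.
refine (filterlim_comp _ _ _
  (fun z : R * R * R => (fst z, Rmax 0 (snd z)))
  (fun z : R * R * R => f (fst (fst z)) (snd (fst z)) (snd z)) _ _ _ _
  (Hf (fst z, Rmax 0 (snd z)) (Rmax_l _ _))).
intros P HP.
assert (Hc : continuous (fun z : R * R * R => (fst z, Rmax 0 (snd z))) z).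
{ apply (continuous_comp_2 fst (fun z : R * R * R => Rmax 0 (snd z)) pair).
  - apply continuous_fst.
  - apply (continuous_comp snd (fun s => Rmax 0 s)).
    + apply continuous_snd.
    + apply continuous_max_0.
  - apply continuous_ext with (fun w : (R * R) * R => w).
    + now intros [].
    + apply continuous_id. }
specialize (Hc _ HP); revert Hc; unfold filtermap.
apply filter_imp; intros w Hw; apply Hw, Rmax_l.
Qed.

Lemma C1_half_space_with (f : R -> R -> R -> R) :
  C1_half_space f ->
  exists fx fy ft, C1_with (fun x y t => f x y (Rmax 0 t)) fx fy ft /\
    forall x y t : R, 0 < t ->
      Defs.Dx f x y t = fx x y t /\ Defs.Dy f x y t = fy x y t /\
      Defs.Dt f x y t = ft x y t.
Proof.
intros [Hf (fx & fy & ft & Hfx & Hfy & Hft & Hd)].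
exists (fun x y t => fx x y (Rmax 0 t)), (fun x y t => fy x y (Rmax 0 t)),
  (fun x y t => ft x y (Rmax 0 t)).
split.
2: { intros x y t Ht; rewrite (Rmax_right 0 t) by lra.
  destruct (Hd x y t Ht) as (D1 & D2 & D3).
  split; [| split]; now apply is_derive_unique. }
do 4 (split; [now apply continuous3_max_0 |]).
intros x y t Ht.
destruct (Hd x y t Ht) as (D1 & D2 & D3).
rewrite (Rmax_right 0 t) by lra.
split; [exact D1 | split; [exact D2 |]].
apply is_derive_ext_loc with (2 := D3).
generalize (open_gt 0 t Ht); apply filter_imp; intros s Hs.
now rewrite Rmax_right by lra.
Qed.

Lemma C1_with_half_space (f fx fy ft : R -> R -> R -> R) :
  C1_with f fx fy ft -> C1_half_space f.
Proof.
assert (Hc : forall f, continuous3 f -> continuous_half_space f).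
{ intros g Hg z _; apply filterlim_filter_le_1 with (2 := Hg z).
  apply filter_le_within. }
intros (Hf & Hfx & Hfy & Hft & Hd).
split; [auto |]; exists fx, fy, ft; auto.
Qed.

(** * The squared positive part *)

(** This is both the profile of the quadratic wave and the building block of the cutoffs; it is C^1
    across 0. *)
Definition pos_sqr (s : R) : R := Rmax 0 s ^ 2.

Lemma pos_sqr_ge_0 (s : R) : 0 <= pos_sqr s.
Proof. apply pow2_ge_0. Qed.

Lemma pos_sqr_gt_0 (s : R) : 0 < s -> 0 < pos_sqr s.
Proof. intros Hs; unfold pos_sqr; rewrite Rmax_right by lra; now apply pow_lt. Qed.

Lemma pos_sqr_neg (s : R) : s <= 0 -> pos_sqr s = 0.
Proof. intros Hs; unfold pos_sqr; rewrite Rmax_left by lra; ring. Qed.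

Lemma continuous_pos_sqr (s : R) : continuous pos_sqr s.
Proof.
unfold pos_sqr; apply (continuous_comp (fun s => Rmax 0 s) (fun r => r ^ 2)).
- apply continuous_max_0.
- apply (ex_derive_continuous (fun r : R => r ^ 2)); auto_derive; auto.
Qed.

Lemma is_derive_pos_sqr (s : R) : is_derive pos_sqr s (2 * Rmax 0 s).
Proof.
apply is_derive_Reals; intros eps Heps.
(* The first-order Taylor remainder is at most [k ^ 2], so the increment may be taken as small as
   [eps] itself. *)
exists (mkposreal eps Heps); intros k Hk Hke; simpl in Hke.
apply Rle_lt_trans with (2 := Hke).
apply (Rmult_le_reg_r (Rabs k)); [now apply Rabs_pos_lt |].
rewrite <- !Rabs_mult.
replace (((pos_sqr (s + k) - pos_sqr s) / k - 2 * Rmax 0 s) * k)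
  with (pos_sqr (s + k) - pos_sqr s - 2 * Rmax 0 s * k) by (field; exact Hk).
rewrite (Rabs_pos_eq (k * k)) by nra.
unfold pos_sqr, Rmax; destruct (Rle_dec 0 (s + k)), (Rle_dec 0 s);
  apply Rabs_le; split; nra.
Qed.

Lemma C1_with_pos_sqr (a b d k : R) :
  C1_with (fun x y t => pos_sqr (k + a * x + b * y + d * t))
    (fun x y t => a * (2 * Rmax 0 (k + a * x + b * y + d * t)))
    (fun x y t => b * (2 * Rmax 0 (k + a * x + b * y + d * t)))
    (fun x y t => d * (2 * Rmax 0 (k + a * x + b * y + d * t))).
Proof.
assert (Hl : continuous3 (fun x y t => k + a * x + b * y + d * t)).
{ repeat first [apply continuous3_plus | apply continuous3_mult
    | apply continuous3_const].
  - intros [[x y] t]; apply (continuous_comp fst fst); apply continuous_fst.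
  - intros [[x y] t]; apply (continuous_comp fst snd);
      [apply continuous_fst | apply continuous_snd].
  - intros [[x y] t]; apply continuous_snd. }
assert (Hm : forall r, continuous3
    (fun x y t => r * (2 * Rmax 0 (k + a * x + b * y + d * t)))).
{ intros r; repeat (apply continuous3_mult; [apply continuous3_const |]).
  intros z; apply (continuous_comp _ (fun s => Rmax 0 s) z (Hl z)).
  apply continuous_max_0. }
split; [| repeat (split; [apply Hm |])].
- intros z; apply (continuous_comp _ pos_sqr z (Hl z)), continuous_pos_sqr.
- intros x y t _.
  split; [| split];
    (apply (is_derive_comp pos_sqr); [apply is_derive_pos_sqr |];
     auto_derive; [exact I | ring]).
Qed.

(** * The energy estimate *)

Lemma continuous_RInt_y (g : R -> R -> R -> R) (a b : R) (z : R * R) :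
  continuous3 g ->
  continuous (fun z : R * R => RInt (fun y => g (fst z) y (snd z)) a b) z.
Proof.
intros Hg.
apply (continuous_RInt_param _ (fun (z : R * R) y => g (fst z) y (snd z))).
intros [[x t] y].
apply (continuous3_comp _ g (fun w : R * R * R => fst (fst w)) snd
  (fun w => snd (fst w))); [exact Hg | | apply continuous_snd |].
- apply (continuous_comp fst fst); apply continuous_fst.
- apply (continuous_comp fst snd); [apply continuous_fst | apply continuous_snd].
Qed.

Lemma continuous_RInt_y_comp (T : UniformSpace) (g : R -> R -> R -> R)
    (a b : R) (h1 h2 : T -> R) (z : T) :
  continuous3 g -> continuous h1 z -> continuous h2 z ->
  continuous (fun z => RInt (fun y => g (h1 z) y (h2 z)) a b) z.
Proof.
intros Hg H1 H2.
apply (continuous_comp_2 h1 h2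
  (fun x t => RInt (fun y => g x y t) a b)); [exact H1 | exact H2 |].
exact (continuous_RInt_y g a b (h1 z, h2 z) Hg).
Qed.

(** * Integrals over a fixed rectangle *)

Definition box_integral (a1 b1 a2 b2 : R) (g : R -> R -> R -> R) (t : R) : R :=
  RInt (fun x => RInt (fun y => g x y t) a2 b2) a1 b1.

Lemma continuous_box_integral (a1 b1 a2 b2 : R) (g : R -> R -> R -> R) (t : R) :
  continuous3 g -> continuous (box_integral a1 b1 a2 b2 g) t.
Proof.
intros Hg.
apply (continuous_RInt_param _ (fun t x => RInt (fun y => g x y t) a2 b2)).
intros z; apply (continuous_RInt_y_comp _ g a2 b2 snd fst z Hg).
- destruct z; apply continuous_snd.
- destruct z; apply continuous_fst.
Qed.

Section Integrability.

Variables (g : R -> R -> R -> R) (Hg : continuous3 g).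

Lemma continuous3_y (x t y : R) : continuous (fun y => g x y t) y.
Proof.
apply (continuous3_comp _ g (fun _ => x) (fun y => y) (fun _ => t)); auto;
  first [apply continuous_const | apply continuous_id].
Qed.

Lemma ex_RInt_y (x t a b : R) : ex_RInt (fun y => g x y t) a b.
Proof.
apply (ex_RInt_continuous (V := R_CompleteNormedModule)).
intros y _; apply continuous3_y.
Qed.

Lemma continuous_inner_RInt (a b t x : R) :
  continuous (fun x => RInt (fun y => g x y t) a b) x.
Proof.
apply (continuous_RInt_y_comp _ g a b (fun x => x) (fun _ => t) x Hg).
- apply continuous_id.
- apply continuous_const.
Qed.

Lemma ex_RInt_inner (a b t c d : R) :
  ex_RInt (fun x => RInt (fun y => g x y t) a b) c d.
Proof.
apply (ex_RInt_continuous (V := R_CompleteNormedModule)).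
intros x _; apply continuous_inner_RInt.
Qed.

End Integrability.

Lemma is_derive_box_integral (a1 b1 a2 b2 : R) (g gx gy gt : R -> R -> R -> R)
    (t : R) :
  C1_with g gx gy gt -> 0 < t ->
  is_derive (box_integral a1 b1 a2 b2 g) t (box_integral a1 b1 a2 b2 gt t).
Proof.
intros (Hg & _ & _ & Hgt & Hd) Ht.
assert (Hc : forall h, continuous3 h -> forall z : R * R, continuous
    (fun z => RInt (fun y => h (snd z) y (fst z)) a2 b2) z).
{ intros h Hh [s x].
  apply (continuous_RInt_y_comp _ h a2 b2 snd fst _ Hh).
  - apply continuous_snd.
  - apply continuous_fst. }
apply (is_derive_RInt_parameter
  (fun t x => RInt (fun y => g x y t) a2 b2)
  (fun t x => RInt (fun y => gt x y t) a2 b2)); [now apply Hc | now apply Hc |].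
generalize (open_gt 0 t Ht); apply filter_imp; intros s Hs x.
assert (Hxy : forall h, continuous3 h -> forall z : R * R,
    continuous (fun z => h x (snd z) (fst z)) z).
{ intros h Hh [r y].
  apply (continuous3_comp _ h (fun _ => x) snd fst _ Hh).
  - apply continuous_const.
  - apply continuous_snd.
  - apply continuous_fst. }
apply (is_derive_RInt_parameter (fun t y => g x y t) (fun t y => gt x y t));
  [now apply Hxy | now apply Hxy |].
generalize (open_gt 0 s Hs); apply filter_imp; intros r Hr y.
now apply Hd.
Qed.

(** One half of the divergence theorem for a flux vanishing on the sides. As [x] is the outer
    variable, the inner integral is first differentiated in [x]; the fundamental theorem then leaves
    its values at [a1] and [b1]. *)
Lemma box_integral_dx (a1 b1 a2 b2 : R) (A Ax Ay At : R -> R -> R -> R) (t : R) :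
  C1_with A Ax Ay At -> 0 < t ->
  (forall y, A a1 y t = 0) -> (forall y, A b1 y t = 0) ->
  box_integral a1 b1 a2 b2 Ax t = 0.
Proof.
intros (HA & HAx & _ & _ & Hd) Ht Ha Hb.
unfold box_integral.
rewrite (is_RInt_unique _ _ _ _ (is_RInt_derive
  (fun x => RInt (fun y => A x y t) a2 b2)
  (fun x => RInt (fun y => Ax x y t) a2 b2) a1 b1
  ltac:(intros x _;
    apply (is_derive_RInt_parameter (fun x y => A x y t) (fun x y => Ax x y t));
    [intros [z y]; apply (continuous3_comp _ A fst snd (fun _ => t)); auto;
       first [apply continuous_fst | apply continuous_snd | apply continuous_const]
    |intros [z y]; apply (continuous3_comp _ Ax fst snd (fun _ => t)); auto;
       first [apply continuous_fst | apply continuous_snd | apply continuous_const]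
    |apply filter_forall; intros z y; now apply Hd])
  ltac:(intros x _; now apply continuous_inner_RInt))).
rewrite (RInt_ext _ (fun _ => 0)) by (intros y _; apply Hb).
rewrite (RInt_ext (fun y => A a1 y t) (fun _ => 0)) by (intros y _; apply Ha).
apply (minus_eq_zero (RInt (fun _ => 0) a2 b2)).
Qed.

Lemma box_integral_dy (a1 b1 a2 b2 : R) (A Ax Ay At : R -> R -> R -> R) (t : R) :
  C1_with A Ax Ay At -> 0 < t ->
  (forall x, A x a2 t = 0) -> (forall x, A x b2 t = 0) ->
  box_integral a1 b1 a2 b2 Ay t = 0.
Proof.
intros (HA & _ & HAy & _ & Hd) Ht Ha Hb.
unfold box_integral.
rewrite (RInt_ext _ (fun _ => 0)).
- rewrite RInt_const; apply Rmult_0_r.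
- intros x _.
  rewrite (is_RInt_unique _ _ _ _ (is_RInt_derive
    (fun y => A x y t) (fun y => Ay x y t) a2 b2
    ltac:(intros y _; now apply Hd)
    ltac:(intros y _; now apply continuous3_y))).
  rewrite Ha, Hb; apply (minus_eq_zero 0).
Qed.

Lemma box_integral_le (a1 b1 a2 b2 : R) (f g : R -> R -> R -> R) (t : R) :
  a1 <= b1 -> a2 <= b2 -> continuous3 f -> continuous3 g ->
  (forall x y, f x y t <= g x y t) ->
  box_integral a1 b1 a2 b2 f t <= box_integral a1 b1 a2 b2 g t.
Proof.
intros H1 H2 Hf Hg Hfg.
apply RInt_le; [exact H1 | now apply ex_RInt_inner | now apply ex_RInt_inner |].
intros x _.
apply RInt_le; [exact H2 | now apply ex_RInt_y | now apply ex_RInt_y |].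
auto.
Qed.

Lemma box_integral_plus (a1 b1 a2 b2 : R) (f g : R -> R -> R -> R) (t : R) :
  continuous3 f -> continuous3 g ->
  box_integral a1 b1 a2 b2 (fun x y t => f x y t + g x y t) t =
  box_integral a1 b1 a2 b2 f t + box_integral a1 b1 a2 b2 g t.
Proof.
intros Hf Hg; unfold box_integral.
rewrite (RInt_ext _
  (fun x => plus (RInt (fun y => f x y t) a2 b2) (RInt (fun y => g x y t) a2 b2))).
- apply (RInt_plus (V := R_CompleteNormedModule)); now apply ex_RInt_inner.
- intros x _; apply (RInt_plus (V := R_CompleteNormedModule)); now apply ex_RInt_y.
Qed.

Lemma box_integral_0 (a1 b1 a2 b2 : R) (g : R -> R -> R -> R) (t : R) :
  (forall x y, g x y t = 0) -> box_integral a1 b1 a2 b2 g t = 0.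
Proof.
intros H0; unfold box_integral.
rewrite (RInt_ext _ (fun _ => 0)).
- rewrite RInt_const; apply Rmult_0_r.
- intros x _; rewrite (RInt_ext _ (fun _ => 0)) by (intros y _; apply H0).
  rewrite RInt_const; apply Rmult_0_r.
Qed.

Lemma box_integral_eq_0 (a1 b1 a2 b2 : R) (g : R -> R -> R -> R) (t x y : R) :
  continuous3 g -> (forall x y, 0 <= g x y t) ->
  box_integral a1 b1 a2 b2 g t = 0 -> a1 < x < b1 -> a2 < y < b2 ->
  g x y t = 0.
Proof.
intros Hg Hpos H0 Hx Hy.
apply (RInt_nonneg_eq_0 (fun y => g x y t) a2 b2); auto.
- intros z; now apply continuous3_y.
- apply (RInt_nonneg_eq_0 (fun x => RInt (fun y => g x y t) a2 b2) a1 b1); auto.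
  + intros z; now apply continuous_inner_RInt.
  + intros z; apply RInt_ge_0; [lra | now apply ex_RInt_y | auto].
Qed.

(** * Decay of a localized energy *)

(** Integrated over the rectangle, the flux terms [Ax] and [By] contribute nothing, so the integral
    of [g] has nonpositive time derivative. The mean value theorem compares the times 0 and [T],
    with continuity alone at time 0. *)
Lemma dissipation_nonincreasing (a1 b1 a2 b2 : R)
    (g gx gy gt A Ax Ay At B Bx By Bt : R -> R -> R -> R) (T : R) :
  a1 <= b1 -> a2 <= b2 ->
  C1_with g gx gy gt -> C1_with A Ax Ay At -> C1_with B Bx By Bt ->
  (forall y t, 0 < t -> A a1 y t = 0) -> (forall y t, 0 < t -> A b1 y t = 0) ->
  (forall x t, 0 < t -> B x a2 t = 0) -> (forall x t, 0 < t -> B x b2 t = 0) ->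
  (forall x y t, 0 < t -> gt x y t + Ax x y t + By x y t <= 0) ->
  0 < T -> box_integral a1 b1 a2 b2 g T <= box_integral a1 b1 a2 b2 g 0.
Proof.
intros H1 H2 Hg HA HB HA1 HA2 HB1 HB2 Hle HT.
pose proof Hg as (Cg & _ & _ & Cgt & _).
pose proof HA as (_ & CAx & _); pose proof HB as (_ & _ & CBy & _).
(* [MVT_gen] may return the endpoint [0], where nothing is known about the
   derivative: there the value is set to [0]. *)
destruct (MVT_gen (box_integral a1 b1 a2 b2 g) 0 T
  (fun t => if Rlt_dec 0 t then box_integral a1 b1 a2 b2 gt t else 0))
  as [t [_ Heq]].
- rewrite Rmin_left, Rmax_right by lra; intros t Ht.
  destruct (Rlt_dec 0 t) as [_ | n]; [| lra].
  now apply is_derive_box_integral with gx gy.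
- intros t _; apply continuity_pt_filterlim.
  exact (continuous_box_integral a1 b1 a2 b2 g t Cg).
- destruct (Rlt_dec 0 t) as [Ht | n]; [| lra].
  enough (box_integral a1 b1 a2 b2 gt t <= 0) by nra.
  assert (Cs : continuous3 (fun x y t => gt x y t + Ax x y t))
    by now apply continuous3_plus.
  pose proof (box_integral_dx a1 b1 a2 b2 A Ax Ay At t HA Ht
    (fun y => HA1 y t Ht) (fun y => HA2 y t Ht)) as IA.
  pose proof (box_integral_dy a1 b1 a2 b2 B Bx By Bt t HB Ht
    (fun x => HB1 x t Ht) (fun x => HB2 x t Ht)) as IB.
  assert (Hs : box_integral a1 b1 a2 b2
      (fun x y t => gt x y t + Ax x y t + By x y t) t <=
      box_integral a1 b1 a2 b2 (fun _ _ _ => 0) t).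
  { apply box_integral_le; auto.
    - now apply continuous3_plus.
    - apply continuous3_const. }
  rewrite (box_integral_plus _ _ _ _ _ By), box_integral_plus in Hs by auto.
  rewrite (box_integral_0 _ _ _ _ (fun _ _ _ => 0)) in Hs by auto.
  lra.
Qed.

(* Supported on [|a x + b y - k| <= r - s t], a slab shrinking at speed [s]. *)
Definition slab (r s a b k x y t : R) : R :=
  pos_sqr ((r + k) + - a * x + - b * y + - s * t) *
  pos_sqr ((r - k) + a * x + b * y + - s * t).

Lemma slab_ge_0 (r s a b k x y t : R) : 0 <= slab r s a b k x y t.
Proof. apply Rmult_le_pos; apply pos_sqr_ge_0. Qed.

(** Depending on the sign of [a * x + b * y - k], one of the two factors has a nonpositive
    argument. *)
Lemma slab_outside (r s a b k x y t : R) :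
  0 <= s * t -> r <= Rabs (a * x + b * y - k) -> slab r s a b k x y t = 0.
Proof.
intros Hst Hr; unfold slab.
destruct (Rle_or_lt 0 (a * x + b * y - k)) as [Hs | Hs].
- rewrite Rabs_pos_eq in Hr by exact Hs.
  rewrite pos_sqr_neg by lra; ring.
- rewrite Rabs_left in Hr by exact Hs.
  rewrite (pos_sqr_neg (r - k + _ + _ + _)) by lra; ring.
Qed.

Lemma slab_center (r s a b k x y t : R) :
  a * x + b * y = k -> s * t < r -> 0 < slab r s a b k x y t.
Proof.
intros Hk Hr; unfold slab.
apply Rmult_lt_0_compat; apply pos_sqr_gt_0; lra.
Qed.

Lemma C1_with_ext (f fx fy ft gx gy gt : R -> R -> R -> R) :
  C1_with f fx fy ft ->
  (forall x y t, fx x y t = gx x y t) -> (forall x y t, fy x y t = gy x y t) ->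
  (forall x y t, ft x y t = gt x y t) -> C1_with f gx gy gt.
Proof.
assert (Hext : forall f g, (forall x y t, f x y t = g x y t) ->
    continuous3 f -> continuous3 g).
{ intros h k Hhk Hh z; apply continuous_ext with (2 := Hh z); auto. }
intros (Hf & Hfx & Hfy & Hft & Hd) Ex Ey Et.
split; [exact Hf |].
split; [exact (Hext _ _ Ex Hfx) |].
split; [exact (Hext _ _ Ey Hfy) |].
split; [exact (Hext _ _ Et Hft) |].
intros x y t Ht; rewrite <- Ex, <- Ey, <- Et; auto.
Qed.

(** The space derivative [D] is a difference of two nonnegative terms and [M] is their sum, so the
    decay in time controls the spatial variation of the cutoff. *)
Lemma C1_with_slab (r s a b k : R) :
  exists D M : R -> R -> R -> R,
    (forall x y t, Rabs (D x y t) <= M x y t) /\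
    C1_with (slab r s a b k) (fun x y t => a * D x y t)
      (fun x y t => b * D x y t) (fun x y t => - s * M x y t).
Proof.
set (p := fun x y t => (r + k) + - a * x + - b * y + - s * t).
set (q := fun x y t => (r - k) + a * x + b * y + - s * t).
exists (fun x y t => pos_sqr (p x y t) * (2 * Rmax 0 (q x y t))
  - 2 * Rmax 0 (p x y t) * pos_sqr (q x y t)).
exists (fun x y t => pos_sqr (p x y t) * (2 * Rmax 0 (q x y t))
  + 2 * Rmax 0 (p x y t) * pos_sqr (q x y t)).
split.
- intros x y t.
  pose proof (Rmult_le_pos _ _ (pos_sqr_ge_0 (p x y t)) (Rmax_l 0 (q x y t))).
  pose proof (Rmult_le_pos _ _ (Rmax_l 0 (p x y t)) (pos_sqr_ge_0 (q x y t))).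
  apply Rabs_le; split; nra.
- eapply C1_with_ext.
  + apply (C1_with_mult _ _ _ _ _ _ _ _
      (C1_with_pos_sqr (- a) (- b) (- s) (r + k))
      (C1_with_pos_sqr a b (- s) (r - k))).
  + intros x y t; unfold p, q; ring.
  + intros x y t; unfold p, q; ring.
  + intros x y t; unfold p, q; ring.
Qed.

(** The shrinking of the cutoff, [- s * m * e], pays for the energy flux across its edge, which is
    at most [s * e] times the slope of the cutoff. *)
Lemma cutoff_dominates (s w c d m e f : R) :
  Rabs d <= m -> Rabs f <= e -> 0 < c -> c + Rabs w <= s ->
  - s * m * e + d * (w * e + c * f) <= 0.
Proof.
intros Hd Hf Hc Hs.
assert (H1 : Rabs (w * e + c * f) <= s * e).
{ pose proof (Rabs_triang (w * e) (c * f)) as Ht.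
  rewrite !Rabs_mult, (Rabs_pos_eq c) in Ht by lra.
  pose proof (Rabs_pos f); rewrite (Rabs_pos_eq e) in Ht by lra.
  nra. }
pose proof (Rle_abs (d * (w * e + c * f))) as H2.
rewrite Rabs_mult in H2.
pose proof (Rmult_le_compat _ _ _ _ (Rabs_pos d) (Rabs_pos _) Hd H1).
lra.
Qed.

(* The flux of the energy [e] is [(w1 e + c P u, w2 e + c P v)]. *)
Lemma symmetric_system_unique (c w1 w2 : R)
    (P Px Py Pt u ux uy ut v vx vy vt q qx qy qt : R -> R -> R -> R) :
  0 < c ->
  C1_with P Px Py Pt -> C1_with u ux uy ut ->
  C1_with v vx vy vt -> C1_with q qx qy qt ->
  (forall x y t, 0 < t ->
     Pt x y t + w1 * Px x y t + w2 * Py x y t + c * (ux x y t + vy x y t) = 0 /\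
     ut x y t + w1 * ux x y t + w2 * uy x y t + c * Px x y t = 0 /\
     vt x y t + w1 * vx x y t + w2 * vy x y t + c * Py x y t = 0 /\
     qt x y t + w1 * qx x y t + w2 * qy x y t = 0) ->
  (forall x y, P x y 0 = 0 /\ u x y 0 = 0 /\ v x y 0 = 0 /\ q x y 0 = 0) ->
  forall x y t, 0 < t ->
    P x y t = 0 /\ u x y t = 0 /\ v x y t = 0 /\ q x y t = 0.
Proof.
intros Hc HP Hu Hv Hq Heq H0 x0 y0 T HT.
set (s := c + Rabs w1 + Rabs w2).
pose proof (Rabs_pos w1) as Hw1; pose proof (Rabs_pos w2) as Hw2.
assert (Hs : 0 < s) by (unfold s; lra).
(* With this half-width the slabs vanish on the sides of the square at all times [t >= 0], yet are
   still positive at its centre at time [T]. *)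
set (r := s * T + 1).
assert (Hr : 0 < r) by (unfold r; nra).
destruct (C1_with_slab r s 1 0 x0) as (D1 & M1 & HM1 & S1).
destruct (C1_with_slab r s 0 1 y0) as (D2 & M2 & HM2 & S2).
pose proof (C1_with_mult _ _ _ _ _ _ _ _ S1 S2) as HS.
pose proof (C1_with_mult _ _ _ _ _ _ _ _ (C1_with_const (/ 2))
  (C1_with_plus _ _ _ _ _ _ _ _
    (C1_with_plus _ _ _ _ _ _ _ _
      (C1_with_mult _ _ _ _ _ _ _ _ HP HP) (C1_with_mult _ _ _ _ _ _ _ _ Hu Hu))
    (C1_with_plus _ _ _ _ _ _ _ _
      (C1_with_mult _ _ _ _ _ _ _ _ Hv Hv) (C1_with_mult _ _ _ _ _ _ _ _ Hq Hq))))
  as He.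
set (e := fun x y t => / 2 * (P x y t * P x y t + u x y t * u x y t
  + (v x y t * v x y t + q x y t * q x y t))).
(* The hole is filled with the partial derivatives of cutoff times flux, as produced by the product
   rule. The two components of the flux are instances. *)
assert (Hflux : forall f fx fy ft w, C1_with f fx fy ft -> _) by
  (intros f fx fy ft w Hf;
   exact (C1_with_mult _ _ _ _ _ _ _ _ HS
    (C1_with_plus _ _ _ _ _ _ _ _
      (C1_with_mult _ _ _ _ _ _ _ _ (C1_with_const w) He)
      (C1_with_mult _ _ _ _ _ _ _ _ (C1_with_const c)
        (C1_with_mult _ _ _ _ _ _ _ _ HP Hf))))).
pose proof (Hflux u ux uy ut w1 Hu) as HA.
pose proof (Hflux v vx vy vt w2 Hv) as HB.
pose proof (C1_with_mult _ _ _ _ _ _ _ _ HS He) as Hg.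
assert (He0 : forall x y t, 0 <= e x y t) by (intros; unfold e; nra).
assert (He1 : forall a b d, a * a + b * b <= 2 * d -> Rabs (a * b) <= d).
{ intros a b d Hd; pose proof (Rle_0_sqr (a + b)); pose proof (Rle_0_sqr (a - b)).
  unfold Rsqr in *; apply Rabs_le; split; lra. }
set (g := fun x y t => slab r s 1 0 x0 x y t * slab r s 0 1 y0 x y t * e x y t).
assert (Hle : box_integral (x0 - r) (x0 + r) (y0 - r) (y0 + r) g T
    <= box_integral (x0 - r) (x0 + r) (y0 - r) (y0 + r) g 0).
{ refine (dissipation_nonincreasing _ _ _ _ _ _ _ _ _ _ _ _ _ _ _ _ _
    _ _ Hg HA HB _ _ _ _ _ HT); try lra.
  - intros y t Ht; cbv beta.
    rewrite (slab_outside r s 1 0); [ring | nra |].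
    replace (1 * (x0 - r) + 0 * y - x0) with (- r) by ring.
    rewrite Rabs_Ropp; apply Rle_abs.
  - intros y t Ht; cbv beta.
    rewrite (slab_outside r s 1 0); [ring | nra |].
    replace (1 * (x0 + r) + 0 * y - x0) with r by ring; apply Rle_abs.
  - intros x t Ht; cbv beta.
    rewrite (slab_outside r s 0 1); [ring | nra |].
    replace (0 * x + 1 * (y0 - r) - y0) with (- r) by ring.
    rewrite Rabs_Ropp; apply Rle_abs.
  - intros x t Ht; cbv beta.
    rewrite (slab_outside r s 0 1); [ring | nra |].
    replace (0 * x + 1 * (y0 + r) - y0) with r by ring; apply Rle_abs.
  - intros x y t Ht; cbv beta.
    destruct (Heq x y t Ht) as (E1 & E2 & E3 & E4).
    specialize (HM1 x y t); specialize (HM2 x y t).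
    pose proof (slab_ge_0 r s 1 0 x0 x y t) as L1.
    pose proof (slab_ge_0 r s 0 1 y0 x y t) as L2.
    assert (K1 := cutoff_dominates s w1 c (D1 x y t) (M1 x y t) (e x y t)
      (P x y t * u x y t) HM1
      ltac:(apply He1; unfold e; nra) Hc ltac:(unfold s; lra)).
    assert (K2 := cutoff_dominates s w2 c (D2 x y t) (M2 x y t) (e x y t)
      (P x y t * v x y t) HM2
      ltac:(apply He1; unfold e; nra) Hc ltac:(unfold s; lra)).
    (* In the product cutoff, a derivative of one slab comes multiplied by the other slab. *)
    apply (Rmult_le_compat_l _ _ _ L2) in K1.
    apply (Rmult_le_compat_l _ _ _ L1) in K2.
    rewrite Rmult_0_r in K1, K2.
    (* After elimination of the time derivatives, the terms with an undifferentiated cutoff cancel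
       because the system is symmetric; the sum of the left sides of [K1] and [K2] remains. *)
    replace (Pt x y t) with
      (- (w1 * Px x y t + w2 * Py x y t + c * (ux x y t + vy x y t))) by lra.
    replace (ut x y t) with
      (- (w1 * ux x y t + w2 * uy x y t + c * Px x y t)) by lra.
    replace (vt x y t) with
      (- (w1 * vx x y t + w2 * vy x y t + c * Py x y t)) by lra.
    replace (qt x y t) with (- (w1 * qx x y t + w2 * qy x y t)) by lra.
    refine (Rle_trans _ _ _ (Req_le _ _ _)
      (Rle_trans _ _ _ (Rplus_le_compat _ _ _ _ K1 K2) (Req_le _ _ _)));
      [unfold e; field | ring]. }
assert (H00 : forall x y, g x y 0 = 0).
{ intros x y; unfold g, e; destruct (H0 x y) as (-> & -> & -> & ->); ring. }
rewrite (box_integral_0 _ _ _ _ g 0 H00) in Hle.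
assert (Hpos : forall x y, 0 <= g x y T).
{ intros x y; unfold g.
  apply Rmult_le_pos; [apply Rmult_le_pos; apply slab_ge_0 | apply He0]. }
assert (Hg0 : g x0 y0 T = 0).
{ apply (box_integral_eq_0 (x0 - r) (x0 + r) (y0 - r) (y0 + r)); auto; try lra.
  - exact (proj1 Hg).
  - apply Rle_antisym; [exact Hle |].
    rewrite <- (box_integral_0 (x0 - r) (x0 + r) (y0 - r) (y0 + r)
      (fun _ _ _ => 0) T) by auto.
    apply box_integral_le; try lra; auto.
    + apply continuous3_const.
    + exact (proj1 Hg). }
assert (He00 : e x0 y0 T = 0).
{ pose proof (slab_center r s 1 0 x0 x0 y0 T ltac:(ring) ltac:(unfold r; lra)).
  pose proof (slab_center r s 0 1 y0 x0 y0 T ltac:(ring) ltac:(unfold r; lra)).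
  unfold g in Hg0.
  (* Both slabs are positive at the centre, so the energy factor must vanish there. *)
  apply Rmult_integral in Hg0; destruct Hg0 as [Hg0 | Hg0]; [| exact Hg0].
  apply Rmult_integral in Hg0; lra. }
unfold e in He00.
repeat split; apply Rsqr_0_uniq; unfold Rsqr; nra.
Qed.

(** * Uniqueness of classical solutions *)

Lemma C1_with_partials (f fx fy ft : R -> R -> R -> R) (x y t : R) :
  C1_with f fx fy ft -> 0 < t ->
  Defs.Dx f x y t = fx x y t /\ Defs.Dy f x y t = fy x y t /\
  Defs.Dt f x y t = ft x y t.
Proof.
intros (_ & _ & _ & _ & Hd) Ht.
destruct (Hd x y t Ht) as (D1 & D2 & D3).
split; [| split]; now apply is_derive_unique.
Qed.

Lemma C1_with_minus (f fx fy ft g gx gy gt : R -> R -> R -> R) :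
  C1_with f fx fy ft -> C1_with g gx gy gt ->
  C1_with (fun x y t => f x y t + -1 * g x y t)
    (fun x y t => fx x y t - gx x y t)
    (fun x y t => fy x y t - gy x y t) (fun x y t => ft x y t - gt x y t).
Proof.
intros Hf Hg.
eapply C1_with_ext.
- apply (C1_with_plus _ _ _ _ _ _ _ _ Hf
    (C1_with_mult _ _ _ _ _ _ _ _ (C1_with_const (-1)) Hg)).
- intros; simpl; ring.
- intros; simpl; ring.
- intros; simpl; ring.
Qed.

Lemma C1_with_scal (k : R) (f fx fy ft : R -> R -> R -> R) :
  C1_with f fx fy ft ->
  C1_with (fun x y t => k * f x y t) (fun x y t => k * fx x y t)
    (fun x y t => k * fy x y t) (fun x y t => k * ft x y t).
Proof.
intros Hf.
eapply C1_with_ext.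
- apply (C1_with_mult _ _ _ _ _ _ _ _ (C1_with_const k) Hf).
- intros; simpl; ring.
- intros; simpl; ring.
- intros; simpl; ring.
Qed.

Section Background.

Variables (gamma : R) (B : state).
Hypotheses (hgamma : 1 < gamma) (hrho : 0 < st_rho B) (hp : 0 < st_p B).

Lemma sound_speed_gt_0 : 0 < sound_speed gamma B.
Proof.
apply sqrt_lt_R0, Rdiv_lt_0_compat; [apply Rmult_lt_0_compat; lra | exact hrho].
Qed.

Lemma gamma_mult_p : gamma * st_p B = st_rho B * sound_speed gamma B ^ 2.
Proof.
unfold sound_speed; rewrite pow2_sqrt; [field; lra |].
apply Rlt_le, Rdiv_lt_0_compat; [apply Rmult_lt_0_compat; lra | exact hrho].
Qed.

Lemma classical_solution_unique (W0 : R -> R -> state)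
    (W1 W2 : R -> R -> R -> state) (x y t : R) :
  classical_solution gamma B W0 W1 -> classical_solution gamma B W0 W2 ->
  0 < t -> W1 x y t = W2 x y t.
Proof.
intros (R1 & U1 & V1 & P1 & E1 & I1) (R2 & U2 & V2 & P2 & E2 & I2) Ht.
pose proof sound_speed_gt_0 as Hc; pose proof gamma_mult_p as Hgp.
set (c := sound_speed gamma B) in *.
apply C1_half_space_with in R1 as (r1x & r1y & r1t & R1 & DR1).
apply C1_half_space_with in U1 as (u1x & u1y & u1t & U1 & DU1).
apply C1_half_space_with in V1 as (v1x & v1y & v1t & V1 & DV1).
apply C1_half_space_with in P1 as (p1x & p1y & p1t & P1 & DP1).
apply C1_half_space_with in R2 as (r2x & r2y & r2t & R2 & DR2).
apply C1_half_space_with in U2 as (u2x & u2y & u2t & U2 & DU2).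
apply C1_half_space_with in V2 as (v2x & v2y & v2t & V2 & DV2).
apply C1_half_space_with in P2 as (p2x & p2y & p2t & P2 & DP2).
pose proof (C1_with_minus _ _ _ _ _ _ _ _ R1 R2) as HR.
pose proof (C1_with_minus _ _ _ _ _ _ _ _ U1 U2) as HU.
pose proof (C1_with_minus _ _ _ _ _ _ _ _ V1 V2) as HV.
pose proof (C1_with_minus _ _ _ _ _ _ _ _ P1 P2) as HP.
(* [p / (rho' c')] symmetrizes the system, and the entropy perturbation
   [rho - p / c'^2] is merely advected. *)
pose proof (C1_with_scal (/ (st_rho B * c)) _ _ _ _ HP) as HP'.
pose proof (C1_with_plus _ _ _ _ _ _ _ _ HR
  (C1_with_scal (- / c ^ 2) _ _ _ _ HP)) as HQ.
destruct (symmetric_system_unique c (st_u B) (st_v B)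
  _ _ _ _ _ _ _ _ _ _ _ _ _ _ _ _ Hc HP' HU HV HQ) with x y t
  as (Z1 & Z2 & Z3 & Z4).
- clear x y t Ht; intros x y t Ht.
  specialize (E1 x y t Ht); specialize (E2 x y t Ht).
  unfold linearized_euler in E1, E2; cbv zeta in E1, E2.
  destruct (DR1 x y t Ht) as (X1 & X2 & X3).
  rewrite X1, X2, X3 in E1; clear X1 X2 X3.
  destruct (DU1 x y t Ht) as (X1 & X2 & X3).
  rewrite X1, X2, X3 in E1; clear X1 X2 X3.
  destruct (DV1 x y t Ht) as (X1 & X2 & X3).
  rewrite X1, X2, X3 in E1; clear X1 X2 X3.
  destruct (DP1 x y t Ht) as (X1 & X2 & X3).
  rewrite X1, X2, X3 in E1; clear X1 X2 X3.
  destruct (DR2 x y t Ht) as (X1 & X2 & X3).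
  rewrite X1, X2, X3 in E2; clear X1 X2 X3.
  destruct (DU2 x y t Ht) as (X1 & X2 & X3).
  rewrite X1, X2, X3 in E2; clear X1 X2 X3.
  destruct (DV2 x y t Ht) as (X1 & X2 & X3).
  rewrite X1, X2, X3 in E2; clear X1 X2 X3.
  destruct (DP2 x y t Ht) as (X1 & X2 & X3).
  rewrite X1, X2, X3 in E2; clear X1 X2 X3.
  rewrite Hgp in E1, E2.
  destruct E1 as (A1 & A2 & A3 & A4), E2 as (B1 & B2 & B3 & B4).
  cbv beta.
  split; [| split; [| split]].
  (* Each symmetrized equation is a linear combination of the original ones: the zeros are rewritten
     backwards into the left sides of the equations of [W1] and [W2]. Here the pressure equation is
     divided by [rho' c']. *)
  + transitivity (/ (st_rho B * c) * (0 - 0)); [| ring].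
    rewrite <- A4 at 1; rewrite <- B4; field; lra.
  + transitivity (0 - 0); [| ring].
    rewrite <- A2 at 1; rewrite <- B2; field; lra.
  + transitivity (0 - 0); [| ring].
    rewrite <- A3 at 1; rewrite <- B3; field; lra.
  (* Density equation minus pressure equation over [c ^ 2]: the divergence terms cancel because the
     coefficient of the latter is now [rho' c ^ 2]. *)
  + transitivity ((0 - 0) - / c ^ 2 * (0 - 0)); [| ring].
    rewrite <- A1 at 1; rewrite <- B1 at 1.
    rewrite <- A4 at 1; rewrite <- B4; field; lra.
- intros x' y'; cbv beta; rewrite (Rmax_left 0 0) by lra.
  rewrite I1, I2; repeat split; ring.
- exact Ht.
- rewrite (Rmax_right 0 t) in * by lra.
  (* The pressures agree once the scaling factor is cancelled; the vanishing entropy difference then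
     gives the densities. *)
  assert (Hk : / (st_rho B * c) <> 0) by (apply Rinv_neq_0_compat; nra).
  apply Rmult_integral in Z1; destruct Z1 as [Z1 | Z1]; [easy |].
  rewrite Z1, Rmult_0_r in Z4.
  destruct (W1 x y t), (W2 x y t); simpl in *; f_equal; lra.
Qed.

(** * The planar wave *)

Lemma quadratic_wave_pos_sqr (rhoR uR pR x y : R) :
  quadratic_wave rhoR uR pR x y =
  mkState (rhoR * pos_sqr x) (uR * pos_sqr x) 0 (pR * pos_sqr x).
Proof.
unfold quadratic_wave; destruct (Rlt_dec 0 x) as [Hx | Hx].
- unfold pos_sqr; now rewrite Rmax_right by lra.
- rewrite pos_sqr_neg by lra; f_equal; ring.
Qed.

Variables rhoR uR pR : R.

Let c := sound_speed gamma B.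

(* Shaped so that [C1_with_pos_sqr] applies. *)
Definition travelling (s x y t : R) : R :=
  pos_sqr (0 + 1 * x + 0 * y + - s * t).

(* The Riemann invariants [p -+ rho' c' u] and the entropy perturbation
   [rho - p / c'^2] travel at speeds [u' -+ c'] and [u'] respectively. *)
Definition planar_wave (x y t : R) : state :=
  let m := 1 / 2 * (pR - st_rho B * c * uR) in
  let l := 1 / 2 * (pR + st_rho B * c * uR) in
  let k := rhoR - pR / c ^ 2 in
  let f1 := travelling (st_u B - c) x y t in
  let f2 := travelling (st_u B + c) x y t in
  let f3 := travelling (st_u B) x y t in
  mkState (m / c ^ 2 * f1 + l / c ^ 2 * f2 + k * f3)
    (- (m / (st_rho B * c)) * f1 + l / (st_rho B * c) * f2) 0
    (m * f1 + l * f2).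

(** Each travelling profile solves the system by itself, and at time 0 all three equal [pos_sqr x].
    The identities [m + l = pR] and [l - m = rho' c' uR], with the choice of [k], recover the
    data. *)
Lemma planar_wave_classical_solution :
  classical_solution gamma B (quadratic_wave rhoR uR pR) planar_wave.
Proof.
pose proof sound_speed_gt_0 as Hc; pose proof gamma_mult_p as Hgp.
fold c in Hc, Hgp.
set (m := 1 / 2 * (pR - st_rho B * c * uR)).
set (l := 1 / 2 * (pR + st_rho B * c * uR)).
set (k := rhoR - pR / c ^ 2).
assert (Ht : forall a s, _) by
  (intros a s; exact (C1_with_scal a _ _ _ _ (C1_with_pos_sqr 1 0 (- s) 0))).
assert (H2 : forall a b, _) by
  (intros a b; exact (C1_with_plus _ _ _ _ _ _ _ _
    (Ht a (st_u B - c)) (Ht b (st_u B + c)))).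
pose proof (C1_with_plus _ _ _ _ _ _ _ _
  (H2 (m / c ^ 2) (l / c ^ 2)) (Ht k (st_u B))) as HR.
pose proof (H2 (- (m / (st_rho B * c))) (l / (st_rho B * c))) as HU.
pose proof (C1_with_const 0) as HV.
pose proof (H2 m l) as HP.
split; [exact (C1_with_half_space _ _ _ _ HR) |].
split; [exact (C1_with_half_space _ _ _ _ HU) |].
split; [exact (C1_with_half_space _ _ _ _ HV) |].
split; [exact (C1_with_half_space _ _ _ _ HP) |].
split.
- intros x y t Htp; unfold linearized_euler; cbv zeta.
  destruct (C1_with_partials _ _ _ _ x y t HR Htp) as (R1 & R2 & R3).
  destruct (C1_with_partials _ _ _ _ x y t HU Htp) as (U1 & U2 & U3).
  destruct (C1_with_partials _ _ _ _ x y t HV Htp) as (V1 & V2 & V3).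
  destruct (C1_with_partials _ _ _ _ x y t HP Htp) as (P1 & P2 & P3).
  (* The components are displayed in the form in which their partial derivatives were computed, so
     that the rewrites below can match. *)
  change (fun x y t => st_rho (planar_wave x y t)) with
    (fun x y t => m / c ^ 2 * travelling (st_u B - c) x y t
      + l / c ^ 2 * travelling (st_u B + c) x y t
      + k * travelling (st_u B) x y t).
  change (fun x y t => st_u (planar_wave x y t)) with
    (fun x y t => - (m / (st_rho B * c)) * travelling (st_u B - c) x y t
      + l / (st_rho B * c) * travelling (st_u B + c) x y t).
  change (fun x y t => st_v (planar_wave x y t)) with
    (fun _ _ _ : R => 0).
  change (fun x y t => st_p (planar_wave x y t)) with
    (fun x y t => m * travelling (st_u B - c) x y t
      + l * travelling (st_u B + c) x y t).
  unfold travelling.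
  rewrite R1, R2, R3, U1, U2, U3, V1, V2, V3, P1, P2, P3, Hgp.
  repeat split; field; lra.
- intros x y; rewrite quadratic_wave_pos_sqr.
  unfold planar_wave, travelling.
  replace (0 + 1 * x + 0 * y + - (st_u B - c) * 0) with x by ring.
  replace (0 + 1 * x + 0 * y + - (st_u B + c) * 0) with x by ring.
  replace (0 + 1 * x + 0 * y + - st_u B * 0) with x by ring.
  f_equal; field; lra.
Qed.

Definition wave_value (tau : R) : state :=
  mkState
    (1 / (2 * c ^ 2) * (pR - st_rho B * c * uR) * (c * tau) ^ 2)
    (1 / 2 * (uR - pR / (st_rho B * c)) * (c * tau) ^ 2)
    0
    (1 / 2 * (pR - st_rho B * c * uR) * (c * tau) ^ 2).

Lemma planar_wave_value (y tau : R) :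
  0 < tau -> planar_wave (st_u B * tau) y tau = wave_value tau.
Proof.
intros Htau; pose proof sound_speed_gt_0 as Hc; fold c in Hc.
unfold planar_wave, travelling.
replace (0 + 1 * (st_u B * tau) + 0 * y + - (st_u B - c) * tau)
  with (c * tau) by ring.
replace (0 + 1 * (st_u B * tau) + 0 * y + - (st_u B + c) * tau)
  with (- (c * tau)) by ring.
replace (0 + 1 * (st_u B * tau) + 0 * y + - st_u B * tau) with 0 by ring.
assert (0 < c * tau) by now apply Rmult_lt_0_compat.
(* The right-going and entropy profiles have arguments [- (c * tau)] and 0, where [pos_sqr]
   vanishes. *)
rewrite (pos_sqr_neg (- (c * tau))), (pos_sqr_neg 0) by lra.
unfold pos_sqr; rewrite Rmax_right by lra.
unfold wave_value; f_equal; field; lra.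
Qed.

(** * Evaluation of the evolution operator *)

(** The parametrization from 0 to [2 * PI] cuts the half circle of positive cosine into two arcs,
    hence two increments of the antiderivative [F]. *)
Lemma is_RInt_half_circle (g F : R -> R) :
  (forall theta, continuous g theta) ->
  (forall theta, is_derive F theta (cos theta ^ 2 * g theta)) ->
  is_RInt (fun theta => pos_sqr (cos theta) * g theta) 0 (2 * PI)
    (F (PI / 2) - F 0 + (F (2 * PI) - F (3 * PI / 2))).
Proof.
intros Hg HF.
pose proof PI_RGT_0 as Hpi.
assert (Hcos : forall theta,
    continuous (fun theta => cos theta ^ 2 * g theta) theta).
{ intros theta; apply (continuous_mult (K := R_AbsRing) (fun r => cos r ^ 2) g);
    [| apply Hg].
  apply (ex_derive_continuous (fun r : R => cos r ^ 2)).
  auto_derive; auto. }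
assert (Hpos : forall a b, a <= b ->
    (forall theta, a < theta < b -> 0 <= cos theta) ->
    is_RInt (fun theta => pos_sqr (cos theta) * g theta) a b (F b - F a)).
{ intros a b Hab Hc.
  apply is_RInt_ext with (fun theta => cos theta ^ 2 * g theta).
  - rewrite Rmin_left, Rmax_right by lra; intros theta Ht.
    unfold pos_sqr; now rewrite Rmax_right by auto.
  - exact (is_RInt_derive F _ a b (fun r _ => HF r) (fun r _ => Hcos r)). }
assert (Hneg : is_RInt (fun theta => pos_sqr (cos theta) * g theta)
    (PI / 2) (3 * PI / 2) 0).
{ apply is_RInt_ext with (fun _ => 0).
  - rewrite Rmin_left, Rmax_right by lra; intros theta Ht.
    rewrite pos_sqr_neg; [symmetry; apply Rmult_0_l |]; apply cos_le_0; lra.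
  - pose proof (is_RInt_const (V := R_NormedModule) (PI / 2) (3 * PI / 2) 0) as H0.
    change (scal (3 * PI / 2 - PI / 2) 0) with ((3 * PI / 2 - PI / 2) * 0) in H0.
    now rewrite Rmult_0_r in H0. }
replace (F (PI / 2) - F 0 + (F (2 * PI) - F (3 * PI / 2))) with
  (plus (F (PI / 2) - F 0) (plus 0 (F (2 * PI) - F (3 * PI / 2))))
  by (unfold plus; simpl; ring).
apply (is_RInt_Chasles (V := R_NormedModule)) with (PI / 2).
- apply Hpos; [lra |]; intros theta Ht; apply cos_ge_0; lra.
- apply (is_RInt_Chasles (V := R_NormedModule)) with (1 := Hneg).
  apply Hpos; [lra |]; intros theta Ht; apply cos_ge_0_3PI2; lra.
Qed.

Lemma cos_3PI_2 : cos (3 * PI / 2) = 0.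
Proof. replace (3 * PI / 2) with (3 * (PI / 2)) by field; apply cos_3PI2. Qed.

Lemma RInt_pos_sqr_cos :
  RInt (fun theta => pos_sqr (cos theta) * 1) 0 (2 * PI) = PI / 2 :> R.
Proof.
rewrite (is_RInt_unique _ _ _ _ (is_RInt_half_circle (fun _ => 1)
  (fun theta => theta / 2 + sin theta * cos theta / 2)
  ltac:(intros theta; apply continuous_const)
  ltac:(intros theta; auto_derive; [exact I |];
    pose proof (sin2_cos2 theta); unfold Rsqr in *; nra))).
rewrite cos_PI2, cos_0, sin_0, cos_2PI, sin_2PI, cos_3PI_2; field.
Qed.

Lemma RInt_pos_sqr_cos_u :
  RInt (fun theta => pos_sqr (cos theta) * (2 * cos theta ^ 2 - 1 / 2))
    0 (2 * PI) = PI / 2 :> R.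
Proof.
rewrite (is_RInt_unique _ _ _ _ (is_RInt_half_circle
  (fun theta => 2 * cos theta ^ 2 - 1 / 2)
  (fun theta => cos theta ^ 3 * sin theta / 2
    + (theta / 2 + sin theta * cos theta / 2))
  ltac:(intros theta;
    apply (ex_derive_continuous (fun r : R => 2 * cos r ^ 2 - 1 / 2));
    auto_derive; auto)
  ltac:(intros theta; auto_derive; [exact I |];
    pose proof (sin2_cos2 theta) as Hs; unfold Rsqr in Hs;
    (* A multiple of [1 - (sin ^ 2 + cos ^ 2)] is added, chosen to make the two sides equal as
       polynomials in sine and cosine. *)
    replace (cos theta ^ 2 * (2 * cos theta ^ 2 - 1 / 2)) with
      (cos theta ^ 2 * (2 * cos theta ^ 2 - 1 / 2)
        + (/ 2 + 3 / 2 * cos theta ^ 2)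
          * (1 - (sin theta * sin theta + cos theta * cos theta)))
      by (rewrite Hs; ring); field))).
rewrite cos_PI2, cos_0, sin_0, cos_2PI, sin_2PI, cos_3PI_2; field.
Qed.

(** The integrand is odd under reflection in the [x]-axis, so the two arcs contribute [1 / 2] and
    [- 1 / 2]. *)
Lemma RInt_pos_sqr_cos_v :
  RInt (fun theta => pos_sqr (cos theta) * (2 * sin theta * cos theta))
    0 (2 * PI) = 0 :> R.
Proof.
rewrite (is_RInt_unique _ _ _ _ (is_RInt_half_circle
  (fun theta => 2 * sin theta * cos theta)
  (fun theta => - cos theta ^ 4 / 2)
  ltac:(intros theta;
    apply (ex_derive_continuous (fun r : R => 2 * sin r * cos r));
    auto_derive; auto)
  ltac:(intros theta; auto_derive; [exact I | field]))).
rewrite cos_PI2, cos_0, cos_2PI, cos_3PI_2; field.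
Qed.

Lemma RInt_scal_half_circle (k : R) (g : R -> R) :
  (forall theta, continuous g theta) ->
  RInt (fun theta => k * (pos_sqr (cos theta) * g theta)) 0 (2 * PI) =
  k * RInt (fun theta => pos_sqr (cos theta) * g theta) 0 (2 * PI).
Proof.
intros Hg.
apply (RInt_scal (V := R_CompleteNormedModule)
  (fun theta => pos_sqr (cos theta) * g theta) 0 (2 * PI) k).
apply (ex_RInt_continuous (V := R_CompleteNormedModule)); intros theta _.
apply (continuous_mult (K := R_AbsRing) (fun r => pos_sqr (cos r)) g);
  [| apply Hg].
apply (continuous_comp cos pos_sqr);
  [apply continuous_cos | apply continuous_pos_sqr].
Qed.

(** Homogeneity of degree two is what extracts the factor [(c * tau) ^ 2] from the data on the
    cone. *)
Lemma pos_sqr_scal (k s : R) : 0 <= k -> pos_sqr (k * s) = k ^ 2 * pos_sqr s.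
Proof.
intros Hk; unfold pos_sqr.
rewrite <- (Rmult_0_r k) at 1; rewrite RmaxRmult by exact Hk; ring.
Qed.

Lemma EG_quad_planar_wave (y tau : R) :
  0 < tau ->
  EG_quad gamma B (quadratic_wave rhoR uR pR) (st_u B * tau) y tau =
  wave_value tau.
Proof.
intros Htau; pose proof sound_speed_gt_0 as Hc.
pose proof PI_RGT_0 as Hpi.
unfold EG_quad; cbv zeta; unfold foot_point, cone_point; fold c; fold c in Hc.
assert (Hct : 0 < c * tau) by now apply Rmult_lt_0_compat.
(* The abscissa of the cone point is [c * tau * cos theta], because the foot point lies on
   [x = 0]. *)
assert (Hq : forall theta z, quadratic_wave rhoR uR pR
    (st_u B * tau - (st_u B - c * cos theta) * tau) z =
    mkState (rhoR * (c * tau) ^ 2 * pos_sqr (cos theta))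
      (uR * (c * tau) ^ 2 * pos_sqr (cos theta)) 0
      (pR * (c * tau) ^ 2 * pos_sqr (cos theta))).
{ intros theta z; rewrite quadratic_wave_pos_sqr.
  replace (st_u B * tau - (st_u B - c * cos theta) * tau)
    with (c * tau * cos theta) by ring.
  rewrite pos_sqr_scal by lra; f_equal; ring. }
assert (Hi : forall (f : R -> R) (k : R) (g : R -> R),
    (forall theta, continuous g theta) ->
    (forall theta, f theta = k * (pos_sqr (cos theta) * g theta)) ->
    RInt f 0 (2 * PI) =
    k * RInt (fun theta => pos_sqr (cos theta) * g theta) 0 (2 * PI)).
{ intros f k g Hg Hf; rewrite <- RInt_scal_half_circle by exact Hg.
  apply RInt_ext; intros theta _; apply Hf. }
cbn [fst snd].
rewrite (Hi _ (pR * (c * tau) ^ 2) (fun _ => 1)), RInt_pos_sqr_cos;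
  [| intros; apply continuous_const | intros; rewrite Hq; simpl; ring].
rewrite (Hi _ (uR * (c * tau) ^ 2) (fun theta => 2 * cos theta ^ 2 - 1 / 2)),
  RInt_pos_sqr_cos_u;
  [| intros theta;
     apply (ex_derive_continuous (fun r : R => 2 * cos r ^ 2 - 1 / 2));
     auto_derive; auto
   | intros; rewrite Hq; simpl; ring].
rewrite (Hi _ (uR * (c * tau) ^ 2) (fun theta => 2 * sin theta * cos theta)),
  RInt_pos_sqr_cos_v;
  [| intros theta;
     apply (ex_derive_continuous (fun r : R => 2 * sin r * cos r));
     auto_derive; auto
   | intros; rewrite Hq; simpl; ring].
rewrite !Hq, quadratic_wave_pos_sqr; cbn [st_rho st_u st_v st_p].
replace (st_u B * tau - st_u B * tau) with 0 by ring.
rewrite cos_0, cos_PI, cos_PI2, cos_3PI_2.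
(* Of the four points at multiples of [PI / 2], only [theta = 0] sees the wave. *)
rewrite (pos_sqr_neg 0), (pos_sqr_neg (-1)) by lra.
replace (pos_sqr 1) with 1 by (unfold pos_sqr; rewrite Rmax_right by lra; ring).
unfold wave_value; f_equal; field; lra.
Qed.

End Background.

Theorem mainTheorem2 (gamma : R) (B : state)
    (hgamma : 1 < gamma) (hrho : 0 < st_rho B) (hp : 0 < st_p B)
    (rhoR uR pR : R) :
  (exists W : R -> R -> R -> state,
     classical_solution gamma B (quadratic_wave rhoR uR pR) W) /\
  (forall y tau : R, 0 < tau ->
     let rho' := st_rho B in
     let c' := sound_speed gamma B in
     let x := st_u B * tau in
     let value_at_P := mkState
       (1 / (2 * c' ^ 2) * (pR - rho' * c' * uR) * (c' * tau) ^ 2)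
       (1 / 2 * (uR - pR / (rho' * c')) * (c' * tau) ^ 2)
       0
       (1 / 2 * (pR - rho' * c' * uR) * (c' * tau) ^ 2) in
     fst (foot_point B x y tau) = 0 /\
     (forall W : R -> R -> R -> state,
        classical_solution gamma B (quadratic_wave rhoR uR pR) W ->
        W x y tau = value_at_P) /\
     EG_quad gamma B (quadratic_wave rhoR uR pR) x y tau = value_at_P).
Proof.
pose proof (planar_wave_classical_solution gamma B hgamma hrho hp rhoR uR pR)
  as Hex.
split; [eexists; exact Hex |].
intros y tau Htau rho' c' x value_at_P.
change value_at_P with (wave_value gamma B uR pR tau).
split; [| split].
- unfold foot_point, x; simpl; ring.
- intros W HW.
  (* By uniqueness, the value of an arbitrary classical solution is read off from the explicit
     planar wave. *)
  rewrite (classical_solution_unique gamma B hgamma hrho hp _ _ _ x y tau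
    HW Hex Htau).
  now apply planar_wave_value.
- now apply EG_quad_planar_wave.
Qed.
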